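(* Let $E$ be a truncated Riesz space, and let $E\oplus\mathbb{R}$ be its Alexandroff unitization. If $E\oplus\mathbb{R}$ is relatively uniformly complete, then $E$ is relatively uniformly complete.
   Context: A truncation on a (real) Riesz space $E$ is a map $x\mapsto\bar{x}$ from $E^{+}$ to $E^{+}$ such that for all $a,b\in E^{+}$: $(\tau_1)$ $a\wedge\bar{b}\leq\bar{a}\leq a$; $(\tau_2)$ $\bar{a}=0$ implies $a=0$. A truncated Riesz space is a Riesz space $E$ equipped with a truncation. The set of fixed points is $\bar{E}=\{x\in E:\overline{|x|}=|x|\}$. The (Alexandroff) unitization $E\oplus\mathbb{R}=\{x+\lambda: x\in E,\lambda\in\mathbb{R}\}$ is the vector space $E\times\mathbb{R}$ (with $E$ identified with $E\times\{0\}$ and $\mathbb{R}$ with $\{0\}\times\mathbb{R}$, so $1=(0,1)$), ordered by the positive cone $(E\oplus\mathbb{R})^{+}=E^{+}\cup\{x+\lambda: x\in E,\ \lambda\in\mathbb{R},\ \lambda>0,\ \tfrac{1}{\lambda}x^{-}\in\bar{E}\}$. It is known that $E\oplus\mathbb{R}$ is a Riesz space, that $E$ is a vector sublattice (indeed a maximal ideal) of it, and that $\bar{x}=x\wedge 1$ for all $x\in E^{+}$. Let $F$ be a Riesz space and $u\in F^{+}$. A sequence $(x_n)$ in $F$ converges $u$-uniformly to $x\in F$ ($x$ is a $u$-uniform limit) if for every real $\epsilon>0$ there is $N_\epsilon$ with $|x_n-x|\leq\epsilon u$ for all $n\geq N_\epsilon$. It is $u$-uniformly Cauchy if for every real $\epsilon>0$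 one has $|x_n-x_m|\leq\epsilon u$ for all sufficiently large $n,m$. $F$ is (relatively) uniformly complete if for every $u\in F^{+}$ every $u$-uniform Cauchy sequence in $F$ has a $u$-uniform limit in $F$. *)

(* Defs.v *)
From HB Require Import structures.
From mathcomp Require Import all_boot all_order all_algebra.
From mathcomp Require Import reals.

Set Implicit Arguments.
Unset Strict Implicit.
Unset Printing Implicit Defensive.

Import Order.TTheory GRing.Theory Num.Theory.
Local Open Scope ring_scope.

(* A Riesz space is an ordered vector space with binary infima and suprema.
   The class does not inherit from Order.Lattice: MathComp's realDomainType is
   already the least common substructure of Zmodule and Lattice, so a new join
   of these two classes cannot be added to the hierarchy. *)
HB.mixin Record Lmodule_POrder_isRiesz (R : realType) E
    of GRing.Lmodule R E & Order.POrder ring_display E := {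
  rmeet : E -> E -> E;
  rjoin : E -> E -> E;
  le_rmeet : forall x y z : E, (x <= rmeet y z) = (x <= y) && (x <= z);
  rjoin_le : forall x y z : E, (rjoin x y <= z) = (x <= z) && (y <= z);
  riesz_leD2r : forall x y z : E, x <= y -> x + z <= y + z;
  riesz_leZ : forall (a : R) (x : E), 0 <= a -> 0 <= x -> 0 <= a *: x;
}.

#[short(type="rieszType")]
HB.structure Definition RieszSpace (R : realType) :=
  { E of GRing.Lmodule R E & Order.POrder ring_display E
       & Lmodule_POrder_isRiesz R E }.

Definition rneg (R : realType) (E : rieszType R) (x : E) : E :=
  rjoin (- x) 0.

Definition rabs (R : realType) (E : rieszType R) (x : E) : E :=
  rjoin x (- x).

(* A truncation is a map on the positive cone.  It is encoded as a map on the
   whole space about which nothing is assumed outside the positive cone, and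
   which is only ever applied to positive elements below. *)
HB.mixin Record Riesz_isTruncated (R : realType) E of RieszSpace R E := {
  trunc : E -> E;
  trunc_ge0 : forall a : E, 0 <= a -> 0 <= trunc a;
  meet_trunc_le : forall a b : E, 0 <= a -> 0 <= b ->
    rmeet a (trunc b) <= trunc a;
  trunc_le : forall a : E, 0 <= a -> trunc a <= a;
  trunc_eq0 : forall a : E, 0 <= a -> trunc a = 0 -> a = 0;
}.

#[short(type="truncRieszType")]
HB.structure Definition TruncatedRieszSpace (R : realType) :=
  { E of RieszSpace R E & Riesz_isTruncated R E }.

Definition trunc_fixed (R : realType) (E : truncRieszType R) : {pred E} :=
  [pred x | trunc (rabs x) == rabs x].
Arguments trunc_fixed {R} E.

Definition unitization (R : realType) (E : truncRieszType R) : Type :=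
  (E * R^o)%type.

HB.instance Definition _ (R : realType) (E : truncRieszType R) :=
  GRing.Lmodule.copy (unitization E) (E * R^o)%type.

Definition unitization_cone (R : realType) (E : truncRieszType R) :
    {pred unitization E} :=
  [pred z : unitization E |
    ((z.2 == 0) && (0 <= z.1))
    || ((0 < (z.2 : R)) && ((z.2 : R)^-1 *: rneg z.1 \in trunc_fixed E))].
Arguments unitization_cone {R} E.

Definition unitization_le (R : realType) (E : truncRieszType R)
  (z w : unitization E) : bool := w - z \in unitization_cone E.

(* The positive part of x + l in the unitization: if l <= 0 and m = - l, it is
   x^+ - m * trunc (x^+ / m), which equals x^+ when m = 0 because 0^-1 = 0;
   the case l > 0 reduces to it through z^+ = z + (- z)^+. *)
Definition unitization_pos_np (R : realType) (E : truncRieszType R)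
    (z : unitization E) : unitization E :=
  let p : E := rjoin z.1 0 in
  let m : R := - z.2 in
  (p - m *: trunc (m^-1 *: p), 0).

Definition unitization_pos (R : realType) (E : truncRieszType R)
    (z : unitization E) : unitization E :=
  if (z.2 : R) <= 0 then unitization_pos_np z
  else z + unitization_pos_np (- z).

Section Riesz.
Context (R : realType) (E : rieszType R).
Implicit Types (x y z : E) (a b : R).

Lemma riesz_lerD2r z x y : (x + z <= y + z) = (x <= y).
Proof.
apply/idP/idP; last exact: riesz_leD2r.
by move=> /(riesz_leD2r _ _ (- z)); rewrite !addrK.
Qed.

Lemma riesz_lerD2l z x y : (z + x <= z + y) = (x <= y).
Proof. by rewrite ![z + _]addrC riesz_lerD2r. Qed.

Lemma riesz_subr_ge0 x y : (0 <= y - x) = (x <= y).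
Proof. by rewrite -[LHS](riesz_lerD2r x) add0r subrK. Qed.

Lemma riesz_lerBlDr x y z : (x - y <= z) = (x <= z + y).
Proof. by rewrite -[LHS](riesz_lerD2r y) subrK. Qed.

Lemma riesz_lerN2 x y : (- x <= - y) = (y <= x).
Proof. by rewrite -[LHS](riesz_lerD2r x) addNr addrC riesz_subr_ge0. Qed.

Lemma riesz_oppr_le0 x : (- x <= 0) = (0 <= x).
Proof. by rewrite -[X in _ <= X]oppr0 riesz_lerN2. Qed.

Lemma riesz_lerD x y z t : x <= y -> z <= t -> x + z <= y + t.
Proof.
move=> xy zt; apply: (@le_trans _ _ (y + z)).
  by rewrite riesz_lerD2r.
by rewrite riesz_lerD2l.
Qed.

Lemma riesz_ler_wZ a x y : 0 <= a -> x <= y -> a *: x <= a *: y.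
Proof.
by move=> a0 xy; rewrite -riesz_subr_ge0 -scalerBr riesz_leZ// riesz_subr_ge0.
Qed.

Lemma riesz_lerZV a x y : 0 < a -> (a^-1 *: x <= y) = (x <= a *: y).
Proof.
move=> a0; have an0 : a != 0 by rewrite gt_eqF.
apply/idP/idP => [/(riesz_ler_wZ (ltW a0))|].
  by rewrite scalerA divff// scale1r.
have ai0 : 0 <= a^-1 by rewrite invr_ge0 ltW.
by move=> /(riesz_ler_wZ ai0); rewrite [X in _ <= X]scalerA mulVf// scale1r.
Qed.

Lemma riesz_lerVZ a x y : 0 < a -> (x <= a^-1 *: y) = (a *: x <= y).
Proof.
move=> a0; rewrite -{2}[a]invrK riesz_lerZV ?invr_gt0//.
Qed.

Lemma riesz_addr_ge0 x y : 0 <= x -> 0 <= y -> 0 <= x + y.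
Proof. by move=> x0 y0; rewrite -[0]addr0 riesz_lerD. Qed.

Lemma le_rjoinl x y : x <= rjoin x y.
Proof. by have := lexx (rjoin x y); rewrite rjoin_le => /andP[]. Qed.

Lemma le_rjoinr x y : y <= rjoin x y.
Proof. by have := lexx (rjoin x y); rewrite rjoin_le => /andP[]. Qed.

Lemma rmeet_lel x y : rmeet x y <= x.
Proof. by have := lexx (rmeet x y); rewrite le_rmeet => /andP[]. Qed.

Lemma rmeet_ler x y : rmeet x y <= y.
Proof. by have := lexx (rmeet x y); rewrite le_rmeet => /andP[]. Qed.

Lemma rjoin_l x y : y <= x -> rjoin x y = x.
Proof.
by move=> yx; apply/eqP; rewrite eq_le le_rjoinl rjoin_le lexx yx.
Qed.

Lemma rmeet_l x y : x <= y -> rmeet x y = x.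
Proof. by move=> xy; apply/eqP; rewrite eq_le rmeet_lel le_rmeet lexx xy. Qed.

Lemma rmeet_r x y : y <= x -> rmeet x y = y.
Proof. by move=> xy; apply/eqP; rewrite eq_le rmeet_ler le_rmeet lexx xy. Qed.

Lemma rmeetxx x : rmeet x x = x.
Proof. exact: rmeet_l. Qed.

Lemma rabs_id x : 0 <= x -> rabs x = x.
Proof.
move=> x0; apply: rjoin_l; apply: (le_trans _ x0).
by rewrite riesz_oppr_le0.
Qed.

End Riesz.

Section Unitization.
Context (R : realType) (E : truncRieszType R).
Implicit Types (x y d : E) (z w v : unitization E).

Lemma trunc0 : trunc (0 : E) = 0.
Proof. by apply/eqP; rewrite eq_le trunc_le// trunc_ge0. Qed.

Lemma truncK x : 0 <= x -> trunc (trunc x) = trunc x.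
Proof.
move=> x0; have t0 := trunc_ge0 _ x0; apply/eqP; rewrite eq_le trunc_le//=.
by rewrite -{1}[trunc x]rmeetxx meet_trunc_le.
Qed.

Lemma trunc_id_le x d : 0 <= x -> x <= d -> trunc d = d -> trunc x = x.
Proof.
move=> x0 xd td; have d0 := le_trans x0 xd.
apply/eqP; rewrite eq_le trunc_le//= -{1}(rmeet_l xd) -{1}td.
exact: meet_trunc_le.
Qed.

Lemma trunc_id_join x y : 0 <= x -> 0 <= y -> trunc x = x -> trunc y = y ->
  trunc (rjoin x y) = rjoin x y.
Proof.
move=> x0 y0 tx ty.
have j0 : 0 <= rjoin x y by rewrite (le_trans x0)// le_rjoinl.
apply/eqP; rewrite eq_le trunc_le//= rjoin_le; apply/andP; split.
  have := meet_trunc_le _ _ j0 x0.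
  by rewrite tx rmeet_r// le_rjoinl.
have := meet_trunc_le _ _ j0 y0.
by rewrite ty rmeet_r// le_rjoinr.
Qed.

Lemma unitization_coneP z :
  reflect (0 <= (z.2 : R) /\
           exists d : E, [/\ 0 <= d, trunc d = d & - z.1 <= (z.2 : R) *: d])
          (z \in unitization_cone E).
Proof.
case: z => x l; rewrite inE /=; apply: (iffP orP) => [[|]|[l0 [d [d0 td xd]]]].
- move=> /andP[/eqP -> x0]; split => //; exists 0; split => //.
    exact: trunc0.
  by rewrite scale0r riesz_oppr_le0.
- move=> /andP[l0]; rewrite inE /= => /eqP tf; split; first exact: ltW.
  have n0 : 0 <= (l : R)^-1 *: rneg x.
    apply: riesz_leZ; last exact: le_rjoinr.
    by rewrite invr_ge0 ltW.
  rewrite rabs_id// in tf.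
  exists ((l : R)^-1 *: rneg x); split => //.
  by rewrite scalerA divff ?gt_eqF// scale1r /rneg le_rjoinl.
- move: l0 xd; rewrite le_eqVlt => /predU1P[<-|l0] xd.
    left; rewrite eqxx /=.
    by move: xd; rewrite scale0r riesz_oppr_le0.
  right; rewrite l0 inE /=.
  have n0 : 0 <= (l : R)^-1 *: rneg x.
    apply: riesz_leZ; last exact: le_rjoinr.
    by rewrite invr_ge0 ltW.
  rewrite rabs_id//; apply/eqP/(@trunc_id_le _ d) => //.
  by rewrite riesz_lerZV// /rneg rjoin_le xd riesz_leZ// ltW.
Qed.

Lemma unitization_cone0 : 0 \in unitization_cone E.
Proof. by apply/orP; left; rewrite /= eqxx lexx. Qed.

Lemma unitization_coneD z w : z \in unitization_cone E ->
  w \in unitization_cone E -> z + w \in unitization_cone E.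
Proof.
case: z w => [x l] [y m] /unitization_coneP/= [l0 [d [d0 td xd]]].
move=> /unitization_coneP/= [m0 [e [e0 te ye]]].
apply/unitization_coneP; split => /=; first exact: addr_ge0.
exists (rjoin d e); split; first by rewrite (le_trans d0)// le_rjoinl.
  exact: trunc_id_join.
rewrite opprD scalerDl; apply: riesz_lerD.
  by apply: (le_trans xd); rewrite riesz_ler_wZ// le_rjoinl.
by apply: (le_trans ye); rewrite riesz_ler_wZ// le_rjoinr.
Qed.

Lemma unitization_coneZ (a : R) z : 0 <= a -> z \in unitization_cone E ->
  a *: z \in unitization_cone E.
Proof.
move=> a0; case: z => x l /unitization_coneP/= [l0 [d [d0 td xd]]].
apply/unitization_coneP; split => /=; first exact: mulr_ge0.
exists d; split => //.
by rewrite -scalerN -[_ *: l]/(a * l) -scalerA riesz_ler_wZ.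
Qed.

Lemma unitization_le_refl : reflexive (@unitization_le R E).
Proof. by move=> z; rewrite /unitization_le subrr unitization_cone0. Qed.

Lemma unitization_le_anti : antisymmetric (@unitization_le R E).
Proof.
move=> [x l] [y m] /andP[/unitization_coneP/= [l0 [d [_ _ xd]]]].
move=> /unitization_coneP/= [m0 [e [_ _ ye]]].
have lm : l = m by apply/eqP; rewrite eq_le -subr_ge0 l0 -subr_ge0 m0.
move: xd ye; rewrite lm !subrr !scale0r !riesz_oppr_le0 !riesz_subr_ge0 => xy yx.
by congr (_, _); apply/eqP; rewrite eq_le xy yx.
Qed.

Lemma unitization_le_trans : transitive (@unitization_le R E).
Proof.
move=> w z v zw wv; rewrite /unitization_le.
have -> : v - z = (w - z) + (v - w) by rewrite [RHS]addrC addrA subrK.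
exact: unitization_coneD.
Qed.

HB.instance Definition _ := Order.Le_isPOrder.Build ring_display
  (unitization E) unitization_le_refl unitization_le_anti unitization_le_trans.

Lemma unitization_leE z w : (z <= w) = (w - z \in unitization_cone E).
Proof. by []. Qed.

Lemma unitization_lerD2r v z w : (z + v <= w + v) = (z <= w).
Proof. by rewrite !unitization_leE opprD addrACA subrr addr0. Qed.

Lemma unitization_lerBrDr v z w : (z <= w - v) = (z + v <= w).
Proof. by rewrite -[LHS](unitization_lerD2r v) subrK. Qed.

Lemma unitization_pos_npP z w : (z.2 : R) <= 0 ->
  (unitization_pos_np z <= w) = (z <= w) && (0 <= w).
Proof.
case: z => x l /= l0; rewrite /unitization_pos_np /=.
set m : R := - l; set p := rjoin x 0; set t := trunc _.
have m0 : 0 <= m by rewrite oppr_ge0.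
have p0 : 0 <= p by rewrite le_rjoinr.
have mp0 : 0 <= m^-1 *: p by rewrite riesz_leZ// invr_ge0.
have t0 : 0 <= t by exact: trunc_ge0.
have tt : trunc t = t by exact: truncK.
have mtp : m *: t <= p.
  move: m0; rewrite le_eqVlt => /predU1P[<-|m0]; first by rewrite scale0r.
  by rewrite -riesz_lerVZ// trunc_le.
have P0 : (0 : unitization E) <= (p - m *: t, 0).
  rewrite unitization_leE subr0; apply/orP; left => /=.
  by rewrite eqxx riesz_subr_ge0.
have Pz : ((x, l) : unitization E) <= (p - m *: t, 0).
  rewrite unitization_leE; apply/unitization_coneP => /=.
  rewrite sub0r; split => //; exists t; split => //.
  rewrite opprB opprB addrA riesz_lerBlDr addrC riesz_lerD2l.
  by rewrite le_rjoinl.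
apply/idP/andP => [Pw|[]]; first by split; [exact: le_trans Pw|exact: le_trans Pw].
case: w => y n; rewrite !unitization_leE subr0.
move=> /unitization_coneP/= [_ [d [d0 td xd]]].
move=> /unitization_coneP/= [n0 [e [e0 te ye]]].
apply/unitization_coneP => /=; rewrite subr0; split => //.
pose f := rjoin d e.
have f0 : 0 <= f by rewrite (le_trans d0)// le_rjoinl.
have tf : trunc f = f by exact: trunc_id_join.
exists f; split => //.
have yf : - y <= n *: f by apply: (le_trans ye); rewrite riesz_ler_wZ// le_rjoinr.
have yf0 : - y - n *: f <= 0 by rewrite riesz_lerBlDr add0r.
suff H : p - y - n *: f <= m *: t.
  by rewrite opprB addrAC riesz_lerBlDr [_ + m *: t]addrC -riesz_lerBlDr.
have Hp : p - y - n *: f <= p.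
  by rewrite -addrA -[X in _ <= X]addr0 riesz_lerD2l.
have nm0 : 0 <= n + m.
  exact: addr_ge0.
have xf : x - y - n *: f <= m *: f.
  rewrite riesz_lerBlDr -scalerDl addrC [m + n]addrC.
  move: xd; rewrite opprB addrC => xd; apply: (le_trans xd).
  by rewrite riesz_ler_wZ// le_rjoinl.
have Hf : p - y - n *: f <= m *: f.
  rewrite riesz_lerBlDr riesz_lerBlDr rjoin_le; apply/andP; split.
    by rewrite -!riesz_lerBlDr.
  rewrite -addrA riesz_addr_ge0 ?riesz_leZ//.
  by rewrite -riesz_lerBlDr sub0r.
move: m0 Hp Hf; rewrite le_eqVlt => /predU1P[<-|m1] Hp Hf.
  by move: Hf; rewrite !scale0r.
rewrite -riesz_lerZV//.
apply: (@le_trans _ _ (rmeet (m^-1 *: p) (trunc f))); last exact: meet_trunc_le.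
rewrite le_rmeet; apply/andP; split.
  by rewrite riesz_ler_wZ// invr_ge0 ltW.
by rewrite tf riesz_lerZV.
Qed.

Lemma unitization_posP z w :
  (unitization_pos z <= w) = (z <= w) && (0 <= w).
Proof.
rewrite /unitization_pos; case: ifPn => [|zn]; first exact: unitization_pos_npP.
rewrite addrC -unitization_lerBrDr unitization_pos_npP; last first.
  by rewrite /= oppr_le0 ltW// ltNge.
rewrite andbC; congr andb; first by rewrite unitization_lerBrDr add0r.
by rewrite unitization_lerBrDr addNr.
Qed.

Definition unitization_meet z w : unitization E := z - unitization_pos (z - w).

Definition unitization_join z w : unitization E := w + unitization_pos (z - w).

Lemma unitization_meetP v z w :
  (v <= unitization_meet z w) = (v <= z) && (v <= w).
Proof.
rewrite /unitization_meet unitization_lerBrDr addrC -unitization_lerBrDr.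
rewrite unitization_posP andbC; congr andb.
  by rewrite unitization_lerBrDr add0r.
by rewrite !unitization_leE opprB [z - v + _]addrC addrA subrK.
Qed.

Lemma unitization_joinP z w v :
  (unitization_join z w <= v) = (z <= v) && (w <= v).
Proof.
rewrite /unitization_join addrC -unitization_lerBrDr unitization_posP.
by congr andb; rewrite unitization_lerBrDr ?subrK// add0r.
Qed.

Lemma unitization_leD2r z w v : z <= w -> z + v <= w + v.
Proof. by rewrite unitization_lerD2r. Qed.

Lemma unitization_leZ (a : R) z : 0 <= a -> 0 <= z -> 0 <= a *: z.
Proof. by rewrite !unitization_leE !subr0; exact: unitization_coneZ. Qed.

HB.instance Definition _ := Lmodule_POrder_isRiesz.Build R (unitization E)
  unitization_meetP unitization_joinP unitization_leD2r unitization_leZ.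

End Unitization.

Definition unif_limit (R : realType) (F : rieszType R) (u : F)
    (x : nat -> F) (l : F) : Prop :=
  forall e : R, 0 < e ->
    exists N : nat, forall n : nat, (N <= n)%N -> rabs (x n - l) <= e *: u.

Definition unif_cauchy (R : realType) (F : rieszType R) (u : F)
    (x : nat -> F) : Prop :=
  forall e : R, 0 < e ->
    exists N : nat, forall n m : nat, (N <= n)%N -> (N <= m)%N ->
      rabs (x n - x m) <= e *: u.

Definition unif_complete (R : realType) (F : rieszType R) : Prop :=
  forall u : F, 0 <= u -> forall x : nat -> F,
    unif_cauchy u x -> exists l : F, unif_limit u x l.

(* Main.v *)
(** The ideal E of its unitization is closed under (u, 0)-uniform limits for u
    in E: the coordinate z |-> z.2 is a positive functional vanishing on
    (u, 0), so a limit (l, r) of elements (x_n, 0) has r = 0, and the order of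
    the unitization restricts to that of E. *)
Require Import Defs.
From mathcomp Require Import all_boot all_order all_algebra.
From mathcomp Require Import reals.

Import Order.TTheory GRing.Theory Num.Theory.
Local Open Scope ring_scope.

Lemma rabs_le (R : realType) (F : rieszType R) (x y : F) :
  (rabs x <= y) = (x <= y) && (- x <= y).
Proof. exact: rjoin_le. Qed.

Lemma unitization_le_snd (R : realType) (E : truncRieszType R)
    (z w : unitization E) :
  z <= w -> (z.2 : R) <= w.2.
Proof.
by rewrite unitization_leE => /unitization_coneP[]; rewrite subr_ge0.
Qed.

(** The difference has scalar part [0], so only the branch of the cone coming from positive elements
    of [E] can contain it. *)
Lemma unitization_le_fst (R : realType) (E : truncRieszType R) (x y : E) :
  ((x, 0) <= (y, 0) :> unitization E) = (x <= y).
Proof.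
by rewrite unitization_leE inE /= subrr eqxx ltxx orbF riesz_subr_ge0.
Qed.

Lemma unitization_rabs_le_fst (R : realType) (E : truncRieszType R) (x u : E) :
  (rabs ((x, 0) : unitization E) <= (u, 0)) = (rabs x <= u).
Proof.
rewrite !rabs_le -!unitization_le_fst.
by have -> : - ((x, 0) : unitization E) = (- x, 0) by congr pair; exact: oppr0.
Qed.

(** Both [z] and [- z] lie below [(u, 0)], and the scalar part is monotone. *)
Lemma unitization_rabs_le_snd (R : realType) (E : truncRieszType R)
    (z : unitization E) (u : E) :
  rabs z <= (u, 0) -> z.2 = 0.
Proof.
rewrite rabs_le => /andP[/unitization_le_snd z0 /unitization_le_snd].
by rewrite oppr_le0 => z1; apply/eqP; rewrite eq_le z0 z1.
Qed.

Theorem proposition4p1 (R : realType) (E : truncRieszType R) :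
  unif_complete (unitization E) -> unif_complete E.
Proof.
move=> EC u u0 x xC.
pose i (y : E) : unitization E := (y, 0).
have iB y z : i y - i z = i (y - z) by congr pair; exact: subrr.
have iZ (e : R) y : e *: i y = i (e *: y) by congr pair; exact: scaler0.
have [||[l r] xl] := EC (i u) _ (fun n => i (x n)).
- by rewrite -[0]/(i 0) unitization_le_fst.
- move=> e /xC[N xN]; exists N => n m Nn Nm.
  by rewrite iB iZ unitization_rabs_le_fst xN.
have r0 : r = 0.
  (* One index at tolerance [1] suffices: the bound [1 *: i u] has scalar part [0], while
     [i (x N) - (l, r)] has scalar part [- r]. *)
  have [N /(_ N (leqnn N))] := xl 1 ltr01.
  rewrite iZ => /unitization_rabs_le_snd /eqP.
  by rewrite /= sub0r oppr_eq0 => /eqP.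
exists l => e /xl[N xN]; exists N => n /xN.
by rewrite r0 -/(i l) iB iZ unitization_rabs_le_fst.
Qed.
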